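(* Suppose $(A_0,B)$ is controllable. Let $D_{J_k}$ be a $k\times k$ ($1\le k\le n$) matrix in Jordan form such that $\mathrm{Spec}(D_{J_k})$ lies in the open right half complex plane. Then all rank $k$ solutions $\mathcal{L}$ of the reduced order simplified strict algebraic Riccati inequality $$-D_{J_k}\mathcal{L}-\mathcal{L}D_{J_k}^T+\mathcal{L}M_k\mathcal{L}<0$$ are parametrized by all $k\times k$ positive definite matrices. Furthermore, all rank $k$ solutions $\mathcal{L}$ of the reduced order simplified algebraic Riccati inequality $$-D_{J_k}\mathcal{L}-\mathcal{L}D_{J_k}^T+\mathcal{L}M_k\mathcal{L}\le 0$$ are parametrized by all $k\times k$ positive semidefinite matrices.
   Context: All matrices are real, and solutions $\mathcal{L}$ are symmetric $k\times k$ matrices. $A_0\in\mathbb{R}^{n\times n}$ and $B\in\mathbb{R}^{n\times m}$. The matrix $D_{J_k}$ is a $k\times k$ sub-matrix, itself in (upper triangular) Jordan form, of the Jordan form of $A_0^T$. The matrix $L_k\in\mathbb{R}^{n\times k}$ has linearly independent columns spanning an $A_0^T$-invariant subspace, with $A_0^TL_k=L_kD_{J_k}$, and $M_k=L_k^TBB^TL_k$. The inequalities arise by substituting $X=L_k\mathcal{L}L_k^T$ into $-A_0^TX-XA_0+XBB^TX\le 0$ (respectively, its left side becomes $L_k(-D_{J_k}\mathcal{L}-\mathcal{L}D_{J_k}^T+\mathcal{L}M_k\mathcal{L})L_k^T$). For a symmetric matrix $R$, $R<0$ means negative definite and $R\le0$ means negative semidefinite. *)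

(* Defs.v *)
From mathcomp Require Import all_boot all_order all_algebra.
From mathcomp Require Import complex.
From mathcomp Require Import classical_sets functions reals.

Set Implicit Arguments.
Unset Strict Implicit.
Unset Printing Implicit Defensive.

Import Order.TTheory GRing.Theory Num.Theory.
Local Open Scope classical_set_scope.
Local Open Scope ring_scope.

Section Definiteness.
Variables (R : realType) (k : nat).
Implicit Types Q : 'M[R]_k.

Definition posdefmx Q :=
  Q^T = Q /\ forall x : 'cV[R]_k, x != 0 -> 0 < (x^T *m Q *m x) 0 0.

Definition possemidefmx Q :=
  Q^T = Q /\ forall x : 'cV[R]_k, 0 <= (x^T *m Q *m x) 0 0.

Definition negdefmx Q :=
  Q^T = Q /\ forall x : 'cV[R]_k, x != 0 -> (x^T *m Q *m x) 0 0 < 0.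

Definition negsemidefmx Q :=
  Q^T = Q /\ forall x : 'cV[R]_k, (x^T *m Q *m x) 0 0 <= 0.

End Definiteness.

(* The columns of [B, AB, ..., A^(n-1) B] span R^n. *)
Definition controllable (R : realType) (n m : nat)
    (A : 'M[R]_n) (B : 'M[R]_(n, m)) : Prop :=
  \rank (\mxrow_(i < n) iter i (mulmx A) B) = n.

Definition spec_open_right_half_plane (R : realType) (k : nat)
    (D : 'M[R]_k) : Prop :=
  forall z : R[i], eigenvalue (map_mx (real_complex R) D) z ->
    0 < complex.Re z.

Definition jordan_block (R : realType) (p : nat) (a : R) : 'M[R]_p :=
  \matrix_(i, j) (if j == i :> nat then a
                  else if j == i.+1 :> nat then 1 else 0).

(* The real Jordan block of a pair of conjugate eigenvalues a +/- i b: its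
   2 x 2 blocks are [a, b; -b, a] on the diagonal and the identity just above
   it. *)
Definition real_jordan_block (R : realType) (p : nat) (a b : R) :
    'M[R]_(p.*2) :=
  \matrix_(i, j) (if j == i :> nat then a
                  else if ~~ odd i && (j == i.+1 :> nat) then b
                  else if odd i && (i == j.+1 :> nat) then - b
                  else if j == i.+2 :> nat then 1 else 0).

(* Jordan form over the reals: block diagonal, with upper triangular Jordan
   blocks for real eigenvalues and real Jordan blocks for pairs of non-real
   conjugate eigenvalues; when the spectrum is real only the former occur. *)
Inductive jordan_form (R : realType) : forall k : nat, 'M[R]_k -> Prop :=
| JordanEmpty (J : 'M[R]_0) : jordan_form J
| JordanReal (p k : nat) (a : R) (J : 'M[R]_k) :
    jordan_form J ->
    jordan_form (block_mx (jordan_block p.+1 a) 0 0 J)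
| JordanComplex (p k : nat) (a b : R) (J : 'M[R]_k) :
    b != 0 -> jordan_form J ->
    jordan_form (block_mx (real_jordan_block p.+1 a b) 0 0 J).

(* J is determined by A only up to the order of the blocks and the signs of the
   imaginary parts b. *)
Definition jordan_form_of (R : realType) (n : nat) (A J : 'M[R]_n) : Prop :=
  jordan_form J /\ exists2 T : 'M[R]_n, T \in unitmx & A *m T = T *m J.

Definition principal_submx (R : realType) (k n : nat)
    (D : 'M[R]_k) (J : 'M[R]_n) : Prop :=
  exists2 f : 'I_k -> 'I_n,
    {homo f : i j / (i < j)%N} & D = mxsub f f J.

Section ReducedRiccati.
Variables (R : realType) (k : nat).
Implicit Types D M L Q : 'M[R]_k.

Definition riccati D M L := - (D *m L) - L *m D^T + L *m M *m L.

Definition strict_are_rank_solution D M : set 'M[R]_k :=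
  [set L | [/\ L^T = L, \rank L = k & negdefmx (riccati D M L)]].

Definition are_rank_solution D M : set 'M[R]_k :=
  [set L | [/\ L^T = L, \rank L = k & negsemidefmx (riccati D M L)]].

(* Dividing the Riccati expression by L on both sides gives the Lyapunov
   equation D^T Y + Y D - M = Q in Y = L^-1; Q is the parameter of the solution
   L, and riccati D M L = - L Q L. *)
Definition lyapunov_param D M L := D^T *m invmx L + invmx L *m D - M.

End ReducedRiccati.

(* Main.v *)
(* Dividing by L turns riccati D M L into - L Q L with D^T Y + Y D = M + Q and
   Y = L^-1.  As D and - D^T have disjoint spectra, this Lyapunov equation has
   exactly one solution Y for every Q, and Y is symmetric when Q is.  If Q is
   positive semidefinite and Y v = 0, then v^T (M + Q) v = 0, whence
   B^T Lk v = 0 and Q v = 0, so Y D v = 0: the kernel of Y is D-invariant and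
   annihilated by B^T Lk.  Hence B^T (A0^T)^i Lk v = 0 for all i, and
   controllability gives v = 0; so Y is invertible and L = Y^-1 exists. *)
From HB Require Import structures.
Require Import Defs.
From mathcomp Require Import all_boot all_order all_algebra.
From mathcomp Require Import complex.
From mathcomp Require Import classical_sets functions reals.
From mathcomp Require Import ring lra.

Set Implicit Arguments.
Unset Strict Implicit.
Unset Printing Implicit Defensive.

Import Order.TTheory GRing.Theory Num.Theory.
Local Open Scope classical_set_scope.
Local Open Scope ring_scope.

(** * Sylvester equations with disjoint spectra *)

Lemma eigenvalue_notunit (F : fieldType) (n : nat) (A : 'M[F]_n) (a : F) :
  eigenvalue A a = (A - a%:M \notin unitmx).
Proof. by rewrite /eigenvalue /eigenspace kermx_eq0 row_free_unit. Qed.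

Lemma eigenvalue_tr (F : fieldType) (n : nat) (A : 'M[F]_n) (a : F) :
  eigenvalue A^T a = eigenvalue A a.
Proof.
by rewrite !eigenvalue_notunit -(unitmx_tr (A - _)) linearB /= tr_scalar_mx.
Qed.

Lemma eigenvalueN (F : fieldType) (n : nat) (A : 'M[F]_n) (a : F) :
  eigenvalue (- A) a = eigenvalue A (- a).
Proof.
rewrite !eigenvalue_notunit raddfN opprK -opprD -scaleN1r unitmxZ //.
by rewrite unitrN1.
Qed.

Lemma horner_mx_intertwine (R : comNzRingType) (n m : nat)
    (A : 'M[R]_n.+1) (B : 'M[R]_m.+1) (X : 'M[R]_(n.+1, m.+1)) (p : {poly R}) :
  A *m X = X *m B -> horner_mx A p *m X = X *m horner_mx B p.
Proof.
move=> AX; elim/poly_ind: p => [|p c IHp].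
  by rewrite !rmorph0 mul0mx mulmx0.
rewrite !rmorphD !rmorphM /= !horner_mx_X !horner_mx_C -!mulmxE.
by rewrite mulmxDl mulmxDr -mulmxA AX !mulmxA IHp scalar_mxC.
Qed.

(** With [p = char_poly A], Cayley-Hamilton turns the intertwining into [X *m p(B) = 0]. Here [p(B)]
    is a product of factors [B - z] over the eigenvalues [z] of [A], each invertible since [z] is
    not an eigenvalue of [B]. *)
Lemma intertwine_disjoint_spectra (F : closedFieldType) (n m : nat)
    (A : 'M[F]_n) (B : 'M[F]_m) (X : 'M[F]_(n, m)) :
  (forall z, eigenvalue A z -> ~~ eigenvalue B z) ->
  A *m X = X *m B -> X = 0.
Proof.
(* [horner_mx] asks for successor sizes; if a dimension is 0, [X] is empty. *)
case: n => [|n] in A X *; first by move=> *; rewrite !flatmx0.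
case: m => [|m] in B X *; first by move=> *; rewrite !thinmx0.
move=> disjAB /(@horner_mx_intertwine _ _ _ _ _ _ (char_poly A)).
rewrite Cayley_Hamilton mul0mx => /esym/eqP.
have [r def_p] := closed_field_poly_normal (char_poly A).
move: def_p; rewrite (monicP (char_poly_monic A)) scale1r => def_p.
suff Bu : horner_mx B (char_poly A) \in unitmx.
  by rewrite mulmx_free_eq0 ?row_free_unit // => /eqP.
rewrite def_p rmorph_prod /=; apply: unitr_prod_in => z rz _.
rewrite rmorphB /= horner_mx_X horner_mx_C.
have := disjAB z; rewrite eigenvalue_root_char def_p root_prod_XsubC rz.
by rewrite eigenvalue_notunit negbK => /(_ isT).
Qed.

(** * The Lyapunov operator *)

Definition lyapunov (R : pzRingType) (k : nat) (D Y : 'M[R]_k) :=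
  D^T *m Y + Y *m D.

Lemma lyapunov_is_linear (R : comPzRingType) (k : nat) (D : 'M[R]_k) :
  linear (lyapunov D).
Proof.
move=> a Y Z; rewrite /lyapunov !linearP /= mulmxDl -scalemxAl.
by rewrite scalerDr addrACA.
Qed.

HB.instance Definition _ (R : comPzRingType) (k : nat) (D : 'M[R]_k) :=
  GRing.isLinear.Build R 'M[R]_k 'M[R]_k _ (lyapunov D)
    (lyapunov_is_linear D).

Lemma tr_lyapunov (R : comPzRingType) (k : nat) (D Y : 'M[R]_k) :
  (lyapunov D Y)^T = lyapunov D Y^T.
Proof. by rewrite /lyapunov linearD /= !trmx_mul trmxK addrC. Qed.

(** Read over [R[i]], the equation is [D^T Y = Y (- D)]: eigenvalues of [D^T] have positive real
    part, those of [- D] negative. *)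
Lemma lyapunov_eq0 (R : realType) (k : nat) (D Y : 'M[R]_k) :
  spec_open_right_half_plane D -> lyapunov D Y = 0 -> Y = 0.
Proof.
move=> specD /eqP; rewrite addr_eq0 -mulmxN => /eqP DY.
apply: (@map_mx_inj _ _ (real_complex R)); rewrite map_mx0.
apply: (@intertwine_disjoint_spectra _ _ _
         (map_mx (real_complex R) D^T) (map_mx (real_complex R) (- D))).
  move=> z; rewrite -map_trmx eigenvalue_tr raddfN eigenvalueN => /specD Dz.
  by apply/negP => /specD; case: z Dz => x y /=; lra.
by rewrite -!map_mxM DY.
Qed.

(** An injective endomorphism of a finite-dimensional space is bijective. *)
Lemma lyapunov_bij (R : realType) (k : nat) (D : 'M[R]_k) :
  spec_open_right_half_plane D -> bijective (lyapunov D).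
Proof.
move=> specD; have kerf : lker (linfun (lyapunov D)) == 0%VS.
  apply/lker0P => Y Z; rewrite !lfunE /= => /eqP.
  rewrite -subr_eq0 -linearB => /eqP/(lyapunov_eq0 specD) /eqP.
  by rewrite subr_eq0 => /eqP.
exists (linfun (lyapunov D))^-1%VF => Y.
  by have := lker0_lfunK kerf Y; rewrite lfunE.
by have := lker0_lfunVK kerf Y; rewrite lfunE.
Qed.

(** * Semidefinite quadratic forms *)

Lemma tr_mul_self_eq0 (R : realDomainType) (n : nat) (x : 'cV[R]_n) :
  (x^T *m x) 0 0 = 0 -> x = 0.
Proof.
rewrite mxE => /eqP; rewrite psumr_eq0; last by move=> i _; rewrite mxE sqr_ge0.
move=> /allP x0; apply/colP => i; have := x0 i (mem_index_enum _).
by rewrite !mxE mulf_eq0 orbb => /eqP.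
Qed.

Lemma tr_mul_self_ge0 (R : realDomainType) (n : nat) (x : 'cV[R]_n) :
  0 <= (x^T *m x) 0 0.
Proof. by rewrite mxE sumr_ge0 // => i _; rewrite mxE sqr_ge0. Qed.

Lemma quadratic_ge0_eq0 (R : realFieldType) (a b : R) :
  0 <= b -> (forall t, 0 <= 2 * t * a + t ^+ 2 * b) -> a = 0.
Proof.
(* The minimizer [- a / b] is shifted to [- a / (b + 1)] so that [b = 0] is covered; the value there
   is still negative unless [a = 0]. *)
move=> b_ge0 /(_ (- a / (b + 1))).
have c_gt0 : 0 < (b + 1)^-1 by rewrite invr_gt0; lra.
have -> : 2 * (- a / (b + 1)) * a + (- a / (b + 1)) ^+ 2 * b
    = - (a ^+ 2 * ((b + 1)^-1 * (1 + (b + 1)^-1))) by field; lra.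
rewrite oppr_ge0 pmulr_lle0 ?mulr_gt0 ?addr_gt0 // => a2_le0.
by apply/eqP; rewrite -sqrf_eq0 eq_le a2_le0 sqr_ge0.
Qed.

(** Evaluating the form at [v + t y] with [y = Q v] gives [2 t (y^T y) + t^2 (y^T Q y) >= 0] for all
    [t], which forces [y^T y = 0]. *)
Lemma possemidefmx_form_eq0 (R : realType) (k : nat) (Q : 'M[R]_k)
    (v : 'cV[R]_k) :
  possemidefmx Q -> (v^T *m Q *m v) 0 0 = 0 -> Q *m v = 0.
Proof.
move=> [Qsym Qge0] vQv; apply: tr_mul_self_eq0.
set y := Q *m v; set a : R := (y^T *m y) 0 0.
set b : R := (y^T *m Q *m y) 0 0.
have b_ge0 : 0 <= b by exact: Qge0.
have yE : y^T = v^T *m Q by rewrite trmx_mul Qsym.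
have mxDE (P S : 'M[R]_1) : (P + S) 0 0 = P 0 0 + S 0 0 by rewrite mxE.
have mxZE t (P : 'M[R]_1) : (t *: P) 0 0 = t * P 0 0 by rewrite mxE.
have quad t : 0 <= 2 * t * a + t ^+ 2 * b.
  have := Qge0 (v + t *: y).
  rewrite [(v + _)^T]linearD /= [(t *: y)^T]linearZ /= !(mulmxDl, mulmxDr).
  rewrite -?scalemxAl -?scalemxAr -?scalemxAl -yE.
  rewrite -(mulmxA y^T Q v) -/y !mxDE !mxZE yE vQv -yE -/a -/b.
  by rewrite add0r => /le_trans; apply; lra.
exact: quadratic_ge0_eq0 b_ge0 quad.
Qed.

Lemma posdefmx_semi (R : realType) (k : nat) (Q : 'M[R]_k) :
  posdefmx Q -> possemidefmx Q.
Proof.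
move=> [Qsym Qgt0]; split=> // x.
have [->|x_neq0] := eqVneq x 0; first by rewrite mulmx0 mxE.
exact/ltW/Qgt0.
Qed.

(** * Congruence and the Riccati expression *)

Lemma sym_congr (R : realType) (k : nat) (T Q : 'M[R]_k) :
  T \in unitmx -> (- (T^T *m Q *m T))^T = - (T^T *m Q *m T) <-> Q^T = Q.
Proof.
move=> Tu; have TTu : T^T \in unitmx by rewrite unitmx_tr.
rewrite raddfN /= !trmx_mul trmxK mulmxA; split=> [/oppr_inj|->//].
by move=> /(can_inj (mulmxK Tu))/(can_inj (mulKmx TTu)).
Qed.

Lemma form_congr (R : realType) (k : nat) (T Q : 'M[R]_k) (x : 'cV[R]_k) :
  (x^T *m - (T^T *m Q *m T) *m x) 0 0 = - ((T *m x)^T *m Q *m (T *m x)) 0 0.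
Proof. by rewrite mulmxN mulNmx mxE trmx_mul !mulmxA. Qed.

(** The change of variable [x -> T x] permutes the nonzero vectors. For a symmetric invertible
    solution, [T = L] makes the left side the Riccati expression. *)
Lemma negdefmx_congr (R : realType) (k : nat) (T Q : 'M[R]_k) :
  T \in unitmx -> negdefmx (- (T^T *m Q *m T)) <-> posdefmx Q.
Proof.
move=> Tu; rewrite /negdefmx sym_congr //; split=> -[Qsym Qdef]; split=> // x x0.
  have := Qdef (invmx T *m x); rewrite form_congr mulKVmx // oppr_lt0; apply.
  by apply: contra_neq x0 => Tx; rewrite -(mulKVmx Tu x) Tx mulmx0.
rewrite form_congr oppr_lt0; apply: Qdef.
by apply: contra_neq x0 => Tx; rewrite -(mulKmx Tu x) Tx mulmx0.
Qed.

Lemma negsemidefmx_congr (R : realType) (k : nat) (T Q : 'M[R]_k) :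
  T \in unitmx -> negsemidefmx (- (T^T *m Q *m T)) <-> possemidefmx Q.
Proof.
move=> Tu; rewrite /negsemidefmx sym_congr //.
split=> -[Qsym Qdef]; split=> // x; last by rewrite form_congr oppr_le0.
by have := Qdef (invmx T *m x); rewrite form_congr mulKVmx // oppr_le0.
Qed.

Lemma riccatiE (R : realType) (k : nat) (D M L : 'M[R]_k) :
  L \in unitmx -> riccati D M L = - (L *m lyapunov_param D M L *m L).
Proof.
move=> Lu; rewrite /riccati /lyapunov_param mulmxBr mulmxDr !mulmxBl mulmxDl.
rewrite mulmxA mulmxKV // mulKVmx // opprB opprD addrC; congr (_ + _).
by rewrite addrC.
Qed.

(** * Controllability and invertibility of Lyapunov solutions *)

Lemma iter_intertwine (R : pzSemiRingType) (n k : nat) (A : 'M[R]_n)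
    (D : 'M[R]_k) (X : 'M[R]_(n, k)) (v : 'cV[R]_k) (i : nat) :
  A *m X = X *m D -> iter i (mulmx A) (X *m v) = X *m iter i (mulmx D) v.
Proof. by move=> AX; elim: i => //= i ->; rewrite !mulmxA AX. Qed.

Lemma tr_iter_mulmx (R : comPzRingType) (n m p : nat) (A : 'M[R]_n)
    (B : 'M[R]_(n, m)) (x : 'M[R]_(n, p)) (i : nat) :
  x^T *m iter i (mulmx A) B = (B^T *m iter i (mulmx A^T) x)^T.
Proof.
rewrite trmx_mul trmxK; elim: i x => // i IHi x.
by rewrite iterS mulmxA iterSr -IHi trmx_mul trmxK.
Qed.

(** The row [x^T] kills every block [A^i B], hence the controllability matrix, whose rows are
    independent. *)
Lemma controllable_tr_eq0 (R : realType) (n m : nat) (A : 'M[R]_n)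
    (B : 'M[R]_(n, m)) (x : 'cV[R]_n) :
  controllable A B -> (forall i, B^T *m iter i (mulmx A^T) x = 0) -> x = 0.
Proof.
move=> ctrl Bx0; apply/eqP; rewrite -trmx_eq0.
rewrite -(mulmx_free_eq0 _ (introT eqP ctrl)) mul_mxrow.
apply/eqP; rewrite -[RHS](@mxrow0 _ _ (fun=> m)); apply: eq_mxrow => i.
by rewrite tr_iter_mulmx Bx0 trmx0.
Qed.

Lemma lyapunov_unitmx (R : realType) (n m k : nat) (A : 'M[R]_n)
    (B : 'M[R]_(n, m)) (X : 'M[R]_(n, k)) (D Q Y : 'M[R]_k) :
  controllable A B -> \rank X = k -> A^T *m X = X *m D -> possemidefmx Q ->
  Y^T = Y -> lyapunov D Y = X^T *m B *m B^T *m X + Q -> Y \in unitmx.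
Proof.
move=> ctrl rkX AX Qpsd Ysym lyapY.
have ker_step (v : 'cV[R]_k) :
    Y *m v = 0 -> B^T *m X *m v = 0 /\ Y *m (D *m v) = 0.
  move=> Yv; have vY : v^T *m Y = 0 by rewrite -Ysym -trmx_mul Yv trmx0.
  have lyapYv : lyapunov D Y *m v = Y *m (D *m v).
    by rewrite mulmxDl -!mulmxA Yv mulmx0 add0r.
  have : (v^T *m (lyapunov D Y *m v)) 0 0 = 0.
    by rewrite lyapYv mulmxA vY mul0mx mxE.
  have gramE : X^T *m B *m B^T *m X *m v = (B^T *m X)^T *m (B^T *m X *m v).
    by rewrite trmx_mul trmxK !mulmxA.
  (* The vanishing number splits as the squared norm of [B^T X v] plus [v^T Q v], both nonnegative,
     so each is zero. *)
  rewrite lyapY mulmxDl mulmxDr gramE [v^T *m (_^T *m _)]mulmxA -trmx_mul.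
  rewrite [v^T *m (Q *m v)]mulmxA [LHS]mxE => /eqP.
  rewrite paddr_eq0 ?tr_mul_self_ge0 //; last exact: Qpsd.2.
  move=> /andP[/eqP/tr_mul_self_eq0 BXv].
  move=> /eqP/(possemidefmx_form_eq0 Qpsd) Qv.
  by rewrite -lyapYv lyapY mulmxDl gramE BXv mulmx0 Qv addr0.
rewrite -row_free_unit; apply: inj_row_free => u uY.
have YuT : Y *m u^T = 0 by rewrite -Ysym -trmx_mul uY trmx0.
have Yiter i : Y *m iter i (mulmx D) u^T = 0.
  by elim: i => //= i /ker_step[].
have Xu0 : X *m u^T = 0.
  apply: (controllable_tr_eq0 ctrl) => i.
  by rewrite (iter_intertwine _ _ AX) mulmxA (ker_step _ (Yiter i)).1.
(* The columns of [X] are independent, so [X u^T = 0] gives [u = 0]. *)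
have XTfree : row_free X^T by rewrite /row_free mxrank_tr rkX.
by apply/eqP; rewrite -(mulmx_free_eq0 _ XTfree) -[u]trmxK -trmx_mul Xu0 trmx0.
Qed.

(** * Bijections between parameters and solutions *)

Unset Implicit Arguments.

Theorem theorem11 (R : realType) (n m k : nat)
    (A0 : 'M[R]_n) (B : 'M[R]_(n, m)) (J : 'M[R]_n) (D : 'M[R]_k)
    (Lk : 'M[R]_(n, k)) (M : 'M[R]_k)
    (Hk1 : (1 <= k)%N) (Hkn : (k <= n)%N)
    (Hctrl : controllable A0 B)
    (HJ : jordan_form_of A0^T J)
    (HDJ : principal_submx D J)
    (HD : jordan_form D)
    (HspecD : spec_open_right_half_plane D)
    (HrkLk : \rank Lk = k)
    (HinvLk : A0^T *m Lk = Lk *m D)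
    (HM : M = Lk^T *m B *m B^T *m Lk) :
  exists Phi : 'M[R]_k -> 'M[R]_k,
    [/\ set_bij [set Q | posdefmx Q] (strict_are_rank_solution D M) Phi,
        set_bij [set Q | possemidefmx Q] (are_rank_solution D M) Phi
      & forall Q : 'M[R]_k, possemidefmx Q ->
          lyapunov_param D M (Phi Q) = Q].
Proof.
have [g fK gK] := lyapunov_bij HspecD.
have MB : M = (B^T *m Lk)^T *m (B^T *m Lk).
  by rewrite HM trmx_mul trmxK !mulmxA.
have Msym : M^T = M by rewrite MB trmx_mul trmxK.
(* [g (M + Q)] and its transpose have the same image [M + Q] under the injective [lyapunov D]. *)
have g_sym Q : possemidefmx Q -> (g (M + Q))^T = g (M + Q).
  move=> [Qsym _]; apply: (can_inj fK).
  by rewrite -tr_lyapunov !gK linearD /= Msym Qsym.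
have g_unit Q : possemidefmx Q -> g (M + Q) \in unitmx.
  move=> Qpsd.
  apply: (lyapunov_unitmx Hctrl HrkLk HinvLk Qpsd).
  - exact: g_sym.
  - by rewrite gK HM.
pose Phi Q := invmx (g (M + Q)).
have PhiK Q : possemidefmx Q -> lyapunov_param D M (Phi Q) = Q.
  move=> Qpsd; rewrite /lyapunov_param invmxK -/(lyapunov D _) gK.
  by rewrite addrC addKr.
(* This holds for every [L]: [invmx] fixes non-invertible matrices, so it is an involution
   everywhere. *)
have paramK L : Phi (lyapunov_param D M L) = L.
  by rewrite /Phi /lyapunov_param addrC subrK -/(lyapunov D _) fK invmxK.
have Phi_sym Q : possemidefmx Q -> (Phi Q)^T = Phi Q.
  by move=> Qpsd; rewrite trmx_inv g_sym.
have Phi_unit Q : possemidefmx Q -> Phi Q \in unitmx.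
  by move=> Qpsd; rewrite unitmx_inv g_unit.
have Phi_rank Q : possemidefmx Q -> \rank (Phi Q) = k.
  by move=> Qpsd; rewrite mxrank_unit ?Phi_unit.
have Phi_riccati Q : possemidefmx Q ->
    riccati D M (Phi Q) = - ((Phi Q)^T *m Q *m Phi Q).
  by move=> Qpsd; rewrite riccatiE ?Phi_unit // PhiK // Phi_sym.
have L_unit (L : 'M[R]_k) : \rank L = k -> L \in unitmx.
  by move=> rL; rewrite -row_free_unit; apply/eqP.
(* Each bijection leaves three goals, the strict case first: [Phi] lands in the solutions, is
   injective by [PhiK], and is surjective by [paramK]. *)
exists Phi; split=> //; split.
- move=> Q Qpd; have Qpsd := posdefmx_semi Qpd; split.
  + exact: Phi_sym.
  + exact: Phi_rank.
  + by rewrite Phi_riccati // negdefmx_congr ?Phi_unit.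
- move=> P Q; rewrite !inE => /posdefmx_semi Ppsd /posdefmx_semi Qpsd eqPhi.
  by rewrite -(PhiK P) // eqPhi PhiK.
(* Symmetry of [L] turns the left factor into [L^T], the shape of a congruence. *)
- move=> L [Lsym rL]; rewrite riccatiE ?L_unit // -{1}Lsym.
  rewrite negdefmx_congr ?L_unit // => Qpd.
  by exists (lyapunov_param D M L).
- move=> Q Qpsd; split.
  + exact: Phi_sym.
  + exact: Phi_rank.
  + by rewrite Phi_riccati // negsemidefmx_congr ?Phi_unit.
- move=> P Q; rewrite !inE => Ppsd Qpsd eqPhi.
  by rewrite -(PhiK P) // eqPhi PhiK.
- move=> L [Lsym rL]; rewrite riccatiE ?L_unit // -{1}Lsym.
  rewrite negsemidefmx_congr ?L_unit // => Qpsd.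
  by exists (lyapunov_param D M L).
Qed.
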